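(* Let $h:\mathbb{R}_+\to\mathbb{R}$ be monotonically increasing and convex. For $A\in\mathbb{P}_n$ let $\lambda^\downarrow_1(A)\ge\cdots\ge\lambda^\downarrow_n(A)$ be its eigenvalues sorted decreasingly. Then for each $1\le k\le n$ the function $A\mapsto \sum_{j=1}^k h(\lambda_j^\downarrow(A))$ is geodesically convex on $\mathbb{P}_n$.
   Context: $\mathbb{P}_n$ denotes the set of $n\times n$ Hermitian positive definite matrices. For $A,B\in\mathbb{P}_n$ and $t\in[0,1]$, $A\#_t B:=A^{1/2}(A^{-1/2}BA^{-1/2})^tA^{1/2}$ (the geodesic from $A$ to $B$ for the Riemannian metric $ds=\|A^{-1/2}dA\,A^{-1/2}\|_F$). A function $\phi$ on $\mathbb{P}_n$ is geodesically convex (g-convex) if $\phi(A\#_tB)\le(1-t)\phi(A)+t\phi(B)$ for all $A,B\in\mathbb{P}_n$, $t\in[0,1]$. *)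

(* Defs.v *)
(* R : realType, complex numbers R[i] (mathcomp-real-closed),
   matrices and spectral decomposition from mathcomp's spectral.v,
   real powers powR from mathcomp-analysis. *)
From HB Require Import structures.
From mathcomp Require Import all_boot all_order all_algebra.
From mathcomp Require Import sesquilinear spectral.
From mathcomp Require Import complex.
From mathcomp Require Import all_classical all_reals exp.

Set Implicit Arguments.
Unset Strict Implicit.
Unset Printing Implicit Defensive.

Import Order.TTheory GRing.Theory Num.Theory.
Local Open Scope ring_scope.
Local Open Scope complex_scope.
Local Open Scope sesquilinear_scope.

Section Defs.
Variable R : realType.
Local Notation C := R[i].

(* Hermitian positive definite n x n complex matrices: the set P_n *)
Definition posdef n (A : 'M[C]_n) : Prop :=
  A \is hermsymmx /\
  forall x : 'rV[C]_n, x != 0 -> 0 < (x *m A *m x ^t*) 0 0.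

(* real power A^s of a Hermitian (positive definite) matrix via its unitary
   diagonalization A = P^-1 diag(d) P (library: spectralmx / spectral_diag):
   A^s = P^-1 diag(d^s) P. *)
Definition powm n (A : 'M[C]_n) (s : R) : 'M[C]_n :=
  invmx (spectralmx A) *m
  diag_mx (map_mx (fun z : C => ((powR (complex.Re z) s)%:C)%C) (spectral_diag A))
  *m spectralmx A.

(* A #_t B = A^{1/2} (A^{-1/2} B A^{-1/2})^t A^{1/2} *)
Definition gmean n (A B : 'M[C]_n) (t : R) : 'M[C]_n :=
  powm A (2^-1) *m powm (powm A (- 2^-1) *m B *m powm A (- 2^-1)) t
  *m powm A (2^-1).

(* geodesic convexity on P_n *)
Definition gconvex n (phi : 'M[C]_n -> R) : Prop :=
  forall (A B : 'M[C]_n) (t : R), posdef A -> posdef B -> 0 <= t <= 1 ->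
    phi (gmean A B t) <= (1 - t) * phi A + t * phi B.

(* eigenvalues of a Hermitian matrix (with multiplicity), sorted decreasingly:
   lambda^down_1 >= ... >= lambda^down_n, as a list of length n
   (index j-1 holds lambda^down_j). *)
Definition eigs_dec n (A : 'M[C]_n) : seq R :=
  sort (fun x y : R => y <= x)
    [seq complex.Re (spectral_diag A 0 i) | i <- enum 'I_n].

End Defs.

(* Main.v *)
(* An orthonormal eigenbasis u_j of G = A #_t B satisfies
   lambda_j(G) = <u_j, G u_j> <= (1 - t) <u_j, A u_j> + t <u_j, B u_j>,
   because d^t <= 1 - t + t d for d > 0 yields G <= (1 - t) A + t B in the
   Loewner order.  Applying h, which is increasing and convex, reduces the claim
   to sum_(j <= k) h(<u_j, A u_j>) <= sum_(j <= k) h(lambda_j(A)) for any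
   orthonormal basis u: <u_j, A u_j> averages the eigenvalues of A with the
   doubly stochastic weights |<u_j, v_i>|^2, so Jensen's inequality bounds the
   left side by sum_i p_i h(lambda_i(A)) with 0 <= p_i <= 1 and sum_i p_i = k. *)
Require Import Defs.
From HB Require Import structures.
From mathcomp Require Import all_boot all_order all_algebra.
From mathcomp Require Import perm.
From mathcomp Require Import sesquilinear spectral.
From mathcomp Require Import complex.
From mathcomp Require Import all_classical all_reals sequences exp.
From mathcomp Require Import ring lra.

Set Implicit Arguments.
Unset Strict Implicit.
Unset Printing Implicit Defensive.

Import Order.TTheory GRing.Theory Num.Theory.
Local Open Scope ring_scope.
Local Open Scope complex_scope.
Local Open Scope sesquilinear_scope.

(** * Scalar inequalities: a tangent-line bound, weighted sums, Jensen *)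

Section RealInequalities.
Variable R : realType.

Lemma powR_le_affine (x t : R) : 0 < x -> 0 <= t <= 1 ->
  x `^ t <= (1 - t) + t * x.
Proof.
move=> x0 /andP[t0 t1].
have -> : x `^ t = expR (t * ln x) by rewrite /powR gt_eqF.
rewrite -{2}(lnK x0).
set L := ln x.
(* tangent line of [expR] at [t * L], evaluated at [0] and at [L] *)
have tangent y : expR (t * L) * (1 + (y - t * L)) <= expR y.
  rewrite -[in leRHS](subrKC (t * L) y) expRD.
  by rewrite ler_wpM2l ?expR_ge0 ?expR_ge1Dx.
have := tangent 0; have := tangent L; rewrite expR0.
move: (expR L) (expR (t * L)) => a b ha hb.
(* With weights [t] at [L] and [1 - t] at [0] the slope terms cancel, since
   [t (L - t L) + (1 - t) (0 - t L) = 0]. *)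
have := ler_wpM2l t0 ha.
have t1' : 0 <= 1 - t by lra.
have := ler_wpM2l t1' hb.
lra.
Qed.

(** Both sides have total weight [k], so subtracting a pivot [c] from every [a i] shifts them
    equally. Terms before [k] become nonnegative with weight at most 1, the others nonpositive. *)
Lemma sum_weights_le (n k : nat) (p : 'I_n -> R) (a : nat -> R) :
  (k <= n)%N ->
  (forall i, 0 <= p i <= 1) -> \sum_i p i = k%:R ->
  (forall i j, (i <= j < n)%N -> a j <= a i) ->
  \sum_i p i * a i <= \sum_(i < k) a i.
Proof.
(* For [k = 0] the pivot is [a 0], which still dominates every term. *)
move=> kn p01 psum a_dec; set c := a k.-1.
have ->: \sum_i p i * a i = \sum_i p i * (a i - c) + c * k%:R.
  rewrite -psum mulr_sumr -big_split /=; apply: eq_bigr => i _; ring.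
have ->: \sum_(i < k) a i = \sum_(i < k) (a i - c) + c * k%:R.
  by rewrite sumrB sumr_const card_ord mulr_natr subrK.
rewrite lerD2r (big_ord_widen n (fun i => a i - c)) // [leRHS]big_mkcond /=.
apply: ler_sum => i _; have /andP[p0 p1] := p01 i.
case: ltnP => ik.
  have : 0 <= a i - c.
    by rewrite subr_ge0; apply: a_dec; case: (k) ik kn => //= m; rewrite ltnS => ->.
  move: (a i - c) => d d0.
  by rewrite ler_piMl.
have : a i - c <= 0.
  by rewrite subr_le0 a_dec // ltn_ord andbT (leq_trans (leq_pred _)).
by move=> ?; rewrite mulr_ge0_le0.
Qed.

Section Jensen.
Variable h : R -> R.
Hypothesis h_conv : forall x y t : R, 0 < x -> 0 < y -> 0 <= t <= 1 ->
  h ((1 - t) * x + t * y) <= (1 - t) * h x + t * h y.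

(* The perspective [W h(X/W)] of [h] is subadditive; the degenerate disjunct
   lets zero weights through. *)
Let below (W X H : R) : Prop :=
  [/\ W = 0, X = 0 & H = 0] \/ [/\ 0 < W, 0 < X & W * h (X / W) <= H].

(** Convexity at [X1 / W1] and [X2 / W2] with weight [W2 / (W1 + W2)], multiplied through by
    [W1 + W2]. *)
Lemma perspective_add W1 X1 H1 W2 X2 H2 :
  below W1 X1 H1 -> below W2 X2 H2 -> below (W1 + W2) (X1 + X2) (H1 + H2).
Proof.
case=> [[-> -> ->]|[w1 x1 b1]]; first by rewrite !add0r.
case=> [[-> -> ->]|[w2 x2 b2]]; first by rewrite !addr0; right.
right; split; [exact: addr_gt0|exact: addr_gt0|].
have w12 : 0 < W1 + W2 by exact: addr_gt0.
have t01 : 0 <= W2 / (W1 + W2) <= 1.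
  by rewrite divr_ge0 ?(ltW w2) ?(ltW w12)//= ler_pdivrMr // mul1r lerDr ltW.
have := h_conv (divr_gt0 x1 w1) (divr_gt0 x2 w2) t01.
have n1 := lt0r_neq0 w1; have n2 := lt0r_neq0 w2; have n12 := lt0r_neq0 w12.
have -> : (1 - W2 / (W1 + W2)) * (X1 / W1) + W2 / (W1 + W2) * (X2 / W2) =
          (X1 + X2) / (W1 + W2) by field; rewrite n1 n2 n12.
move=> /(ler_wpM2l (ltW w12)) /le_trans; apply.
apply: le_trans (lerD b1 b2).
rewrite le_eqVlt; apply/orP; left; apply/eqP; field; exact: n12.
Qed.

(** Induction with [below] as invariant avoids renormalizing partial weights; at total weight 1 the
    perspective is [h] itself. *)
Lemma jensen_sum (n : nat) (w x : 'I_n -> R) :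
  (forall i, 0 <= w i) -> \sum_i w i = 1 -> (forall i, 0 < x i) ->
  h (\sum_i w i * x i) <= \sum_i w i * h (x i).
Proof.
move=> w0 w1 x0.
have : below (\sum_i w i) (\sum_i w i * x i) (\sum_i w i * h (x i)).
  apply: (big_ind3 below) => [|*|i _]; [by left|exact: perspective_add|].
  have := w0 i; rewrite le_eqVlt => /predU1P[<-|wi]; first by left; rewrite !mul0r.
  by right; split; rewrite ?mulr_gt0 // mulrAC divff ?gt_eqF // mul1r.
rewrite w1 => -[[/eqP]|[_ _]]; first by rewrite oner_eq0.
by rewrite mul1r divr1.
Qed.

End Jensen.
End RealInequalities.

(** * Quadratic forms, congruence and diagonalization *)

Section HermitianMatrices.
Variable R : realType.
Local Notation C := R[i].

(** The squared modulus, valued in [R] so that it can weight real sums. *)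
Definition sqnorm (z : C) : R := complex.Re z ^+ 2 + complex.Im z ^+ 2.

Lemma sqnorm_ge0 z : 0 <= sqnorm z.
Proof. by rewrite addr_ge0 ?sqr_ge0. Qed.

Lemma mul_conj_sqnorm (z : C) : z * Num.conj z = (sqnorm z)%:C.
Proof. by rewrite -normCK add_Re2_Im2. Qed.

Lemma conj_real (x : R) : Num.conj x%:C = x%:C :> C.
Proof. exact: conjc_real. Qed.

Definition qform n (A : 'M[C]_n) (x : 'rV[C]_n) : C := (x *m A *m x^t*) 0 0.

Definition rdiag n (d : 'I_n -> R) : 'M[C]_n := diag_mx (\row_i (d i)%:C).

Lemma rdiag_adj n (d : 'I_n -> R) : (rdiag d)^t* = rdiag d.
Proof.
apply/matrixP => i j; rewrite !mxE rmorphMn /= conj_real eq_sym.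
by case: eqP => // ->.
Qed.

Lemma rdiagM n (c d : 'I_n -> R) : rdiag c *m rdiag d = rdiag (fun i => c i * d i).
Proof.
rewrite mulmx_diag; congr diag_mx; apply/rowP => i.
by rewrite !mxE -rmorphM.
Qed.

Lemma qform_rdiag n (d : 'I_n -> R) (x : 'rV[C]_n) :
  qform (rdiag d) x = (\sum_i sqnorm (x 0 i) * d i)%:C.
Proof.
rewrite /qform mul_mx_diag mxE rmorph_sum; apply: eq_bigr => i _.
by rewrite !mxE mulrAC mul_conj_sqnorm -rmorphM.
Qed.

Lemma qform_congr n (A S : 'M[C]_n) x : qform (S *m A *m S^t*) x = qform A (x *m S).
Proof. by rewrite /qform trmx_mul map_mxM !mulmxA. Qed.

Lemma qform_adj_congr n (A S : 'M[C]_n) x :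
  qform (S^t* *m A *m S) x = qform A (x *m S^t*).
Proof. by rewrite -qform_congr trmxCK. Qed.

Lemma qform_unitary n (P : 'M[C]_n) x : P \is unitarymx ->
  qform 1%:M (x *m P^t*) = qform 1%:M x.
Proof.
move=> Pu; rewrite -qform_congr mulmx1 trmxCK.
by rewrite -[P^t*]mul1mx mulmxKtV.
Qed.

Lemma hermsymmxE n (A : 'M[C]_n) : (A \is hermsymmx) = (A == A^t*).
Proof. by rewrite is_hermitianmxE expr0 scale1r. Qed.

Lemma posdef_adj n (A : 'M[C]_n) : posdef A -> A^t* = A.
Proof. by case; rewrite hermsymmxE => /eqP <-. Qed.

(** The form vanishes on the left kernel, which must therefore be zero. *)
Lemma posdef_unit n (A : 'M[C]_n) : posdef A -> A \in unitmx.
Proof.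
case=> _ A0; rewrite -row_free_unit -kermx_eq0; apply/eqP/row_matrixP => i.
apply/eqP; rewrite row0; apply/negPn/negP => /A0.
by rewrite -row_mul mulmx_ker row0 mul0mx mxE ltxx.
Qed.

Lemma posdef_congr n (A S : 'M[C]_n) : S \in unitmx -> posdef A ->
  posdef (S *m A *m S^t*).
Proof.
move=> Su [Ah A0]; split.
  by rewrite hermsymmxE !trmx_mul !map_mxM trmxCK mulmxA (posdef_adj (conj Ah A0)).
move=> x x0; rewrite -/(qform _ _) qform_congr A0 //.
by apply: contraNneq x0 => /(congr1 (mulmx^~ (invmx S))); rewrite mulmxK // mul0mx => ->.
Qed.

Lemma posdef_rdiag n (d : 'I_n -> R) : (forall i, 0 < d i) -> posdef (rdiag d).
Proof.
move=> d0; split; first by rewrite hermsymmxE rdiag_adj.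
move=> x x0; rewrite -/(qform _ _) qform_rdiag ltcR.
have [i xi] : exists i, x 0 i != 0.
  apply/existsP; apply: contraNT x0; rewrite negb_exists => /forallP x0.
  by apply/eqP/rowP => i; rewrite mxE; apply/eqP; have := x0 i; rewrite negbK.
have sq0 : 0 < sqnorm (x 0 i).
  by rewrite -ltcR -mul_conj_sqnorm mul_conjC_gt0.
rewrite (bigD1 i) //= ltr_wpDr ?mulr_gt0 // sumr_ge0 // => j _.
by rewrite mulr_ge0 ?sqnorm_ge0 ?ltW.
Qed.

Lemma posdef_diagonalizable n (A : 'M[C]_n)
    (d := fun i => complex.Re (spectral_diag A 0 i)) :
  posdef A ->
  A = (spectralmx A)^t* *m rdiag d *m spectralmx A /\ forall i, 0 < d i.
Proof.
move=> Apd; have [Ah A0] := Apd.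
have E : A = (spectralmx A)^t* *m rdiag d *m spectralmx A.
  have -> : rdiag d = diag_mx (spectral_diag A).
    rewrite /rdiag; suff -> : \row_i (d i)%:C = spectral_diag A by [].
    apply/rowP => i; rewrite mxE /d RRe_real //.
    by have /mxOverP := hermitian_spectral_diag_real Ah; apply.
  rewrite -(invmx_unitary (spectral_unitarymx A)).
  exact/orthomx_spectralP/hermitian_normalmx.
split=> // i.
pose P := spectralmx A.
have Pu : P \is unitarymx by exact: spectral_unitarymx.
have D : rdiag d = P *m A *m P^t*.
  rewrite E -/P !mulmxA (unitarymxP Pu) mul1mx.
  by rewrite -mulmxA (unitarymxP Pu) mulmx1.
(* The form of [rdiag d] at the [i]-th basis vector is [d i]. *)
have [_ /(_ (delta_mx 0 i))] : posdef (rdiag d).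
  by rewrite D; apply: posdef_congr => //; apply: unitarymx_unit.
rewrite -/(qform _ _) qform_rdiag ltcR (bigD1 i) //= big1 => [|j ji]; last first.
  by rewrite mxE (negPf ji) andbF /sqnorm /= expr0n addr0 mul0r.
rewrite mxE !eqxx /sqnorm /= expr0n expr1n !addr0 mul1r; apply.
apply/eqP => /matrixP/(_ 0 i); rewrite !mxE !eqxx => /eqP.
by rewrite oner_eq0.
Qed.

(** * Real powers through the spectral decomposition *)

Section RealPowers.
Variables (n : nat) (A : 'M[C]_n).
Hypothesis Apd : posdef A.
Local Notation P := (spectralmx A).
Let d i := complex.Re (spectral_diag A 0 i).

Lemma powmE s : powm A s = P^t* *m rdiag (fun i => d i `^ s) *m P.
Proof.
rewrite /powm (invmx_unitary (spectral_unitarymx A)) /rdiag.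
suff -> : map_mx (fun z : C => (complex.Re z `^ s)%:C) (spectral_diag A) =
  \row_i (d i `^ s)%:C by [].
by apply/rowP => i; rewrite !mxE.
Qed.

Lemma powm_posdef s : posdef (powm A s).
Proof.
rewrite powmE -[X in _ *m X]trmxCK; apply: posdef_congr.
  by rewrite unitarymx_unit // trmxC_unitary spectral_unitarymx.
have [_ d0] := posdef_diagonalizable Apd.
by apply: posdef_rdiag => i; rewrite powR_gt0 // d0.
Qed.

Lemma powmD r s : powm A (r + s) = powm A r *m powm A s.
Proof.
have [_ d0] := posdef_diagonalizable Apd.
rewrite (powmE r) (powmE s) !mulmxA (mulmxtVK _ (spectral_unitarymx A)).
rewrite -(mulmxA (P^t*) (rdiag _)) rdiagM powmE.
suff -> : (fun i => d i `^ (r + s)) = (fun i => d i `^ r * d i `^ s) by [].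
apply/funext => i; rewrite powRD //; apply/implyP => _.
exact/lt0r_neq0/d0.
Qed.

Lemma powm0 : powm A 0 = 1%:M.
Proof.
rewrite powmE; have -> : rdiag (fun i => d i `^ 0) = 1%:M.
  by apply/matrixP => i j; rewrite !mxE powRr0.
by rewrite mulmx1 -(invmx_unitary (spectral_unitarymx A)) mulVmx ?spectral_unit.
Qed.

Lemma powm1 : powm A 1 = A.
Proof.
have [E d0] := posdef_diagonalizable Apd.
rewrite powmE [RHS]E.
suff -> : (fun i => d i `^ 1) = d by [].
by apply/funext => i; rewrite powRr1 // ltW // d0.
Qed.

(** All three matrices are diagonal in the eigenbasis of [A], so the Loewner bound reduces to
    [powR_le_affine] at each eigenvalue. *)
Lemma qform_powm_le t x : 0 <= t <= 1 ->
  complex.Re (qform (powm A t) x) <=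
  (1 - t) * complex.Re (qform 1%:M x) + t * complex.Re (qform A x).
Proof.
move=> t01; have Pu := spectral_unitarymx A.
have [E d0] := posdef_diagonalizable Apd.
(* The identity form is moved to the rotated vector as well, so that all three sums share the same
   weights. *)
rewrite powmE [X in _ <= _ + _ * complex.Re (qform X _)]E -(qform_unitary _ Pu).
rewrite !qform_adj_congr.
have -> : 1%:M = rdiag (fun=> 1) :> 'M[C]_n.
  by apply/matrixP => i j; rewrite !mxE.
rewrite !qform_rdiag /= !mulr_sumr -big_split /=.
apply: ler_sum => i _; rewrite mulr1 mulrCA (mulrC (1 - t)) -mulrDr.
by rewrite ler_wpM2l ?sqnorm_ge0 // powR_le_affine // d0.
Qed.

End RealPowers.

(** * Weighted geometric mean against arithmetic mean *)

Section GeometricMean.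
Variables (n : nat) (A B : 'M[C]_n).
Hypotheses (Apd : posdef A) (Bpd : posdef B).

Lemma gmean_posdef t : posdef (gmean A B t).
Proof.
have S := powm_posdef Apd.
rewrite /gmean -[X in _ *m X](posdef_adj (S _)).
apply: posdef_congr; first exact/posdef_unit/S.
apply: powm_posdef; rewrite -[X in _ *m X](posdef_adj (S _)).
by apply: posdef_congr Bpd; exact/posdef_unit/S.
Qed.

(** Congruence by [A^{1/2}] sends the identity to [A] and [A^{-1/2} B A^{-1/2}] to [B], so the claim
    is [qform_powm_le] at the vector [x A^{1/2}]. *)
Lemma qform_gmean_le t x : 0 <= t <= 1 ->
  complex.Re (qform (gmean A B t) x) <=
  (1 - t) * complex.Re (qform A x) + t * complex.Re (qform B x).
Proof.
move=> t01; have S := powm_posdef Apd.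
set H := powm A 2^-1; set K := powm A (- 2^-1).
have HK : H *m K = 1%:M by rewrite -powmD // subrr powm0.
have KH : K *m H = 1%:M by rewrite -powmD // addNr powm0.
have half : 2^-1 + 2^-1 = 1 :> R by lra.
have HH : H *m H = A by rewrite -powmD // half powm1.
have Ha : H^t* = H by exact: posdef_adj (S _).
have Mpd : posdef (K *m B *m K).
  rewrite -[X in _ *m X](posdef_adj (S _)).
  by apply: posdef_congr Bpd; exact/posdef_unit/S.
have -> : gmean A B t = H *m powm (K *m B *m K) t *m H^t* by rewrite Ha.
(* Transparent [H], [K] would let [mulmxA] rewrite inside [powm]. *)
rewrite qform_congr; clearbody H K.
have EA : qform 1%:M (x *m H) = qform A x.
  by rewrite -(qform_congr 1%:M H) Ha mulmx1 HH.
have EB : qform (K *m B *m K) (x *m H) = qform B x.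
  by rewrite -(qform_congr _ H) Ha !mulmxA HK mul1mx -mulmxA KH mulmx1.
rewrite -EA -EB; exact: (qform_powm_le Mpd (x *m H) t01).
Qed.

End GeometricMean.
End HermitianMatrices.

(** * Doubly stochastic weights and sorted eigenvalues *)

Section Eigenvalues.
Variable R : realType.
Local Notation C := R[i].

Lemma sqnorm_unitary_row n (W : 'M[C]_n) i : W \is unitarymx ->
  \sum_j sqnorm (W i j) = 1.
Proof.
move=> /unitarymxP/matrixP/(_ i i); rewrite !mxE eqxx => Wii.
apply: (@complexI R); rewrite rmorph_sum /= -[RHS]Wii.
by apply: eq_bigr => j _; rewrite !mxE mul_conj_sqnorm.
Qed.

Lemma sqnorm_conj (z : C) : sqnorm (Num.conj z) = sqnorm z.
Proof.
by apply: (@complexI R); rewrite -!mul_conj_sqnorm conjCK mulrC.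
Qed.

(** The adjoint of [W] is unitary too, so its rows have unit norm. *)
Lemma sqnorm_unitary_col n (W : 'M[C]_n) j : W \is unitarymx ->
  \sum_i sqnorm (W i j) = 1.
Proof.
rewrite -trmxC_unitary => /(sqnorm_unitary_row j) <-.
by apply: eq_bigr => i _; rewrite !mxE sqnorm_conj.
Qed.

Lemma size_eigs_dec n (A : 'M[C]_n) : size (eigs_dec A) = n.
Proof. by rewrite size_sort size_map size_enum_ord. Qed.

Lemma eigs_dec_noninc n (A : 'M[C]_n) i j : (i <= j < n)%N ->
  nth 0 (eigs_dec A) j <= nth 0 (eigs_dec A) i.
Proof.
move=> /andP[ij jn].
have tot : total (fun x y : R => y <= x) by move=> x y; exact: le_total.
have tr : transitive (fun x y : R => y <= x).
  by move=> y x z yx zy; apply: le_trans zy yx.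
have refl : reflexive (fun x y : R => y <= x) by move=> x.
apply: (sorted_leq_nth tr refl 0 (sort_sorted tot _)) => //.
- by rewrite inE size_eigs_dec (leq_ltn_trans ij).
- by rewrite inE size_eigs_dec.
Qed.

(** Links the sorted list to the diagonalization, and so each sorted eigenvalue to a row of
    [spectralmx A]. *)
Lemma eigs_dec_perm n (A : 'M[C]_n) : exists s : 'S_n,
  forall i : 'I_n, nth 0 (eigs_dec A) i = complex.Re (spectral_diag A 0 (s i)).
Proof.
pose t := [tuple complex.Re (spectral_diag A 0 i) | i < n].
have /tuple_permP[s Es] : perm_eq (eigs_dec A) t.
  by rewrite perm_sort /= enumT.
exists s => i.
by rewrite Es -tnth_nth !tnth_mktuple.
Qed.

Lemma row_perm_unitary n (P : 'M[C]_n) (s : 'S_n) :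
  P \is unitarymx -> row_perm s P \is unitarymx.
Proof.
move=> /row_unitarymxP Pu; apply/row_unitarymxP => i j.
by rewrite !row_permEsub !row_rowsub Pu (inj_eq perm_inj).
Qed.

Lemma qform_spectral n (A : 'M[C]_n) x : posdef A ->
  complex.Re (qform A x) =
  \sum_i sqnorm ((x *m (spectralmx A)^t*) 0 i) * complex.Re (spectral_diag A 0 i).
Proof.
by move=> /posdef_diagonalizable[E _]; rewrite [in LHS]E qform_adj_congr qform_rdiag.
Qed.

Lemma qform_eigenvector n (A : 'M[C]_n) i : posdef A ->
  complex.Re (qform A (row i (spectralmx A))) = complex.Re (spectral_diag A 0 i).
Proof.
move=> Apd; rewrite qform_spectral // -row_mul (unitarymxP (spectral_unitarymx A)).
rewrite (bigD1 i) //= big1 => [|j ji].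
  by rewrite !mxE eqxx /sqnorm /= expr1n expr0n !addr0 mul1r.
by rewrite !mxE eq_sym (negPf ji) /sqnorm /= expr0n addr0 mul0r.
Qed.

(** The assumptions on [h] concern positive arguments only, so each value fed to [h] needs this. *)
Lemma posdef_qform_gt0 n (A U : 'M[C]_n) i : posdef A -> U \is unitarymx ->
  0 < complex.Re (qform A (row i U)).
Proof.
move=> [_ A0] Uu; have /A0 : row i U != 0.
  apply/eqP => U0; have /row_unitarymxP/(_ i i) := Uu.
  by rewrite U0 linear0l eqxx => /esym/eqP; rewrite oner_eq0.
by rewrite ltcE => /andP[].
Qed.

(** * Majorization and geodesic convexity *)

Section Majorization.
Variable h : R -> R.
Hypothesis h_incr : forall x y : R, 0 < x -> x <= y -> h x <= h y.
Hypothesis h_conv : forall x y t : R, 0 < x -> 0 < y -> 0 <= t <= 1 ->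
  h ((1 - t) * x + t * y) <= (1 - t) * h x + t * h y.

Lemma sum_qform_le_eigs n k (A U : 'M[C]_n) :
  posdef A -> U \is unitarymx -> (k <= n)%N ->
  \sum_(j < n | (j < k)%N) h (complex.Re (qform A (row j U))) <=
  \sum_(i < k) h (nth 0 (eigs_dec A) i).
Proof.
move=> Apd Uu kn; set d := fun i => complex.Re (spectral_diag A 0 i).
have [_ d0] := posdef_diagonalizable Apd.
pose W := U *m (spectralmx A)^t*.
have Wu : W \is unitarymx.
  by apply: mul_unitarymx Uu _; rewrite trmxC_unitary spectral_unitarymx.
have [s Es] := eigs_dec_perm A.
(* The weight is at most 1 as part of a unit column sum, and the [k] unit row sums give total [k].
   Column [s i] belongs to the [i]-th sorted eigenvalue. *)
pose p i := \sum_(j < n | (j < k)%N) sqnorm (W j (s i)).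
apply: le_trans (_ : \sum_i p i * h (nth 0 (eigs_dec A) i) <= _).
  apply: le_trans (_ : \sum_(j < n | (j < k)%N) \sum_i sqnorm (W j i) * h (d i) <= _).
    apply: ler_sum => j _; rewrite qform_spectral // -row_mul -/W.
    under eq_bigr do rewrite mxE.
    apply: jensen_sum => // [i|]; first exact: sqnorm_ge0.
    exact: sqnorm_unitary_row.
  rewrite exchange_big /= (reindex_inj (@perm_inj _ s)) /=.
  by apply: ler_sum => i _; rewrite Es mulr_suml.
apply: (sum_weights_le (a := fun i => h (nth 0 (eigs_dec A) i))) => //.
- move=> i; rewrite sumr_ge0 => [|j _]; last exact: sqnorm_ge0.
  rewrite -(sqnorm_unitary_col (s i) Wu) /p [leLHS]big_mkcond /=.
  by apply: ler_sum => j _; case: ifP => // _; exact: sqnorm_ge0.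
- rewrite exchange_big /= (eq_bigr (fun=> 1)) => [|j _]; last first.
    by rewrite -(sqnorm_unitary_row j Wu) [RHS](reindex_inj (@perm_inj _ s)).
  by rewrite -(big_ord_widen n (fun=> 1)) // sumr_const card_ord.
(* Monotonicity of [h] keeps the values in the decreasing order of the eigenvalues. *)
- move=> i j ij; apply: h_incr; last exact: eigs_dec_noninc.
  have /andP[_ jn] := ij.
  by rewrite (Es (Ordinal jn)).
Qed.

Lemma gconvex_sum_eigs n k : (k <= n)%N ->
  gconvex (fun A : 'M[C]_n => \sum_(j < k) h (nth 0 (eigs_dec A) j)).
Proof.
move=> kn A B t Apd Bpd t01; have Gpd := gmean_posdef Apd Bpd t.
set G := gmean A B t in Gpd *.
have [s Es] := eigs_dec_perm G.
(* Row [j] of [U] is an eigenvector for the [j]-th largest eigenvalue of [G]; this one basis tests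
   both [A] and [B]. *)
pose U := row_perm s (spectralmx G).
have Uu : U \is unitarymx by apply/row_perm_unitary/spectral_unitarymx.
have /andP[t0 t1] := t01; have t1' : 0 <= 1 - t by rewrite subr_ge0.
apply: le_trans (lerD
  (ler_wpM2l t1' (sum_qform_le_eigs Apd Uu kn))
  (ler_wpM2l t0 (sum_qform_le_eigs Bpd Uu kn))).
rewrite (big_ord_widen n (fun j => h (nth 0 (eigs_dec G) j))) //.
rewrite !mulr_sumr -big_split /=; apply: ler_sum => j _.
have qA := posdef_qform_gt0 j Apd Uu; have qB := posdef_qform_gt0 j Bpd Uu.
(* Convexity joins the two values of [h]; monotonicity then leaves only the comparison of forms. *)
apply: le_trans (h_conv qA qB t01).
have -> : nth 0 (eigs_dec G) j = complex.Re (qform G (row j U)).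
  by rewrite Es /U row_permEsub row_rowsub qform_eigenvector.
by apply: h_incr; [exact: posdef_qform_gt0|exact: qform_gmean_le].
Qed.

End Majorization.
End Eigenvalues.

Theorem theorem1 (R : realType) (h : R -> R)
  (h_incr : forall x y : R, 0 < x -> x <= y -> h x <= h y)
  (h_conv : forall x y t : R, 0 < x -> 0 < y -> 0 <= t <= 1 ->
      h ((1 - t) * x + t * y) <= (1 - t) * h x + t * h y)
  (n k : nat) (hk1 : (1 <= k)%N) (hkn : (k <= n)%N) :
  gconvex (fun A : 'M[R[i]]_n =>
             \sum_(j < k) h (nth 0 (eigs_dec A) j)).
Proof. exact: gconvex_sum_eigs. Qed.
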